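(* Let $X_1,\dotsc,X_k$ be locally compact Polish spaces. Let $c\colon X_1\times\dotsb\times X_k\to\mathbb{R}$ be a bounded Lipschitz function. Let $\mu_i$ be a Borel probability measure on $X_i$ for each $i=1,\dotsc,k$. Then the supremum of the sum of integrals $$\sum_{i=1}^k\int_{X_i}f_i\, d\mu_i$$ taken over the set of continuous, bounded functions $f_i\in\mathcal{C}(X_i)$, $i=1,\dotsc,k$, such that $$\sum_{i=1}^kf_i(x_i)\leq c(x_1,\dotsc,x_k)\quad\text{for all }x_i\in X_i,\ i=1,\dotsc,k,$$ is equal to the infimum of integrals $$\int_{X_1\times\dotsb\times X_k} c\,d\pi$$ over all $\pi\in \Gamma (\mu_1,\dotsc,\mu_k)$, where $\Gamma (\mu_1,\dotsc,\mu_k)$ is the set of all Borel probability measures on $X_1\times\dotsb\times X_k$ whose marginals on $X_i$ are $\mu_i$ for $i=1,\dotsc,k$. Moreover, both the supremum and the infimum are attained.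
   Context: $\mathcal{C}(X)$ denotes the space of bounded continuous real functions on $X$. The Polish spaces are regarded as equipped with metrics inducing their topologies, with respect to which (and the corresponding product metric) $c$ is Lipschitz. *)

(* Defs.v *)
From HB Require Import structures.
From mathcomp Require Import all_boot all_order all_algebra.
From mathcomp Require Import all_classical all_reals all_analysis.

Set Implicit Arguments.
Unset Strict Implicit.
Unset Printing Implicit Defensive.

Import Order.TTheory GRing.Theory Num.Theory.
Import numFieldNormedType.Exports.

Local Open Scope classical_set_scope.
Local Open Scope ring_scope.

(* Measurable types are pointed in the library, so the Borel structure needs a
   base point. Nothing is lost here: a space that carries a probability measure
   is nonempty. *)
#[short(type="pmetricType")]
HB.structure Definition PointedMetric (K : numDomainType) :=
  {M of Metric K M & Pointed M}.

#[short(type="completeMetricType")]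
HB.structure Definition CompleteMetric (K : numDomainType) :=
  {M of Metric K M & Complete M}.

Definition separable (T : topologicalType) : Prop :=
  exists2 D : set T, countable D & dense D.

Definition homeomorphism (T U : topologicalType) (f : T -> U) : Prop :=
  continuous f /\
  exists g : U -> T, [/\ continuous g, cancel f g & cancel g f].

Definition completely_metrizable (R : realType) (T : topologicalType) : Prop :=
  exists (M : completeMetricType R) (f : T -> M), homeomorphism f.

(* Polishness depends on the topology only: when [T] carries a metric, that
   metric is not required to be complete. *)
Definition polish (R : realType) (T : topologicalType) : Prop :=
  separable T /\ completely_metrizable R T.

Notation borel T := (g_sigma_algebraType (@open T)).

Section transport.
Context {R : realType} {k : nat} (X : 'I_k -> pmetricType R).

(* The [l^1] product metric; the other usual product metrics (maximum,
   Euclidean) are Lipschitz equivalent to it because there are finitely many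
   factors. The pseudometric which the library puts on [prod_topology X] is
   not suitable: it handles countable products and is bounded, and only its
   uniformity is that of the product. *)
Definition prod_mdist (x y : prod_topology X) : R :=
  \sum_(i < k) mdist (x i) (y i).

Definition prod_lipschitz (c : prod_topology X -> R) : Prop :=
  exists L : R, forall x y, `|c x - c y| <= L * prod_mdist x y.

Definition dual_admissible (c : prod_topology X -> R)
    : set (forall i, X i -> R) :=
  [set f : forall i, X i -> R |
           (forall i, continuous (f i) /\ bounded_fun (f i)) /\
           (forall x : prod_topology X, \sum_(i < k) f i (x i) <= c x)].

Definition couplings (mu : forall i, probability (borel (X i)) R)
    : set (probability (borel (prod_topology X)) R) :=
  [set pi | forall (i : 'I_k) (A : set (borel (X i))), measurable A ->
     pushforward pi (fun x : borel (prod_topology X) => x i : borel (X i)) A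
     = mu i A].

End transport.

(* Main.v *)
(** Consider the sublinear functional which sends a bounded function [h] on the
    product to the infimum of [sum_i int g_i d mu_i] over bounded Borel [g_i]
    with [h(x) <= sum_i g_i(x_i)]. By Hahn-Banach there is an additive positive
    functional [L] below it for which [L c] is the supremum of the dual problem
    over bounded Borel functions. On indicators, [L] is a finitely additive
    probability on all subsets of the product whose marginals are the [mu i].
    The [mu i] are tight because the spaces are sigma-compact, so [L] is tight,
    and inner regularization by compact sets followed by Caratheodory's theorem
    gives a Borel probability [pi] with [pi U <= L 1_U] for every open [U].
    Hence [pi] is a coupling, and integrating the level sets of [c] gives
    [int c d pi <= L c].

    For the dual, any admissible Borel family can be shifted, truncated and
    replaced by its Lipschitz envelopes [x |-> sup_y (f_i y - K d(x, y))],
    where [K] is a Lipschitz constant of [c], without decreasing its value.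
    The uniformly bounded, equi-Lipschitz admissible families are pointwise
    compact, and tightness makes the value continuous on them, so the supremum
    is attained, at least at [L c]. The easy inequality closes the circle. *)

Require Import Defs.
From HB Require Import structures.
From mathcomp Require Import all_boot all_order all_algebra.
From mathcomp Require Import all_classical all_reals all_analysis.
From mathcomp Require Import measurable_realfun ring lra.
Import Order.TTheory GRing.Theory Num.Theory.
Import numFieldNormedType.Exports.

Set Implicit Arguments.
Unset Strict Implicit.
Unset Printing Implicit Defensive.

Local Open Scope classical_set_scope.
Local Open Scope ring_scope.

(** * Dominated additive functionals *)

Section sublinear.
Context {R : realType} {V : lmodType R} (S : set V).
Hypothesis SD : forall u v, S u -> S v -> S (u + v).
Hypothesis SZ : forall a u, S u -> S (a *: u).

(** The laws are relative to a subspace [S] because [marginal_sup] is controlled only on bounded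
    functions. *)
Definition sublinear_on (p : V -> R) :=
  (forall u v, S u -> S v -> p (u + v) <= p u + p v) /\
  (forall a u, 0 < a -> S u -> p (a *: u) = a * p u).

Let SN u : S u -> S (- u).
Proof. by rewrite -scaleN1r; exact: SZ. Qed.

Lemma sublinear_on0 p u : sublinear_on p -> S u -> p 0 = 0.
Proof.
move=> [_ pZ] Su; have S0 : S 0 by rewrite -(scale0r u); exact: SZ.
by have := pZ 2 0 ltac:(by []) S0; rewrite scaler0; lra.
Qed.

Lemma sublinear_onN p u : sublinear_on p -> S u -> - p (- u) <= p u.
Proof.
move=> sp Su; have := sp.1 u (- u) Su (SN Su).
by rewrite subrr (sublinear_on0 sp Su); lra.
Qed.

Lemma sublinear_onZ p a u : sublinear_on p -> S u -> 0 <= a ->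
  p (a *: u) = a * p u.
Proof.
move=> sp Su; rewrite le_eqVlt => /orP[/eqP <-|a0]; last exact: sp.2.
by rewrite scale0r mul0r (sublinear_on0 sp Su).
Qed.

(** The one-step reduction of Hahn-Banach: [t = 0] puts it below [p], while [t = 1] at [- y] gives
    at most [- p y], so an additive functional below it is at least [p y] at [y]. *)
Definition shear (p : V -> R) (y x : V) : R :=
  inf [set p (x + t *: y) - t * p y | t in [set t | 0 <= t]].

(** Subadditivity for [t *: y = (x + t *: y) - x]; it keeps the infimum in [shear] finite. *)
Lemma shear_lbound p y x : sublinear_on p -> S y -> S x ->
  lbound [set p (x + t *: y) - t * p y | t in [set t | 0 <= t]] (- p (- x)).
Proof.
move=> sp Sy Sx _ [t /= t0 <-].
have Sty : S (t *: y) by exact: SZ.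
have := sp.1 (x + t *: y) (- x) (SD Sx Sty) (SN Sx).
by rewrite addrAC subrr add0r (sublinear_onZ sp)//; lra.
Qed.

Lemma shear_le p y x t : sublinear_on p -> S y -> S x -> 0 <= t ->
  shear p y x <= p (x + t *: y) - t * p y.
Proof.
move=> sp Sy Sx t0; apply: ge_inf; last by exists t.
by exists (- p (- x)); exact: shear_lbound.
Qed.

Lemma shear_adherent p y x e : sublinear_on p -> S y -> S x -> 0 < e ->
  exists2 t, 0 <= t & p (x + t *: y) - t * p y < shear p y x + e.
Proof.
move=> sp Sy Sx e0.
have [|_ [t /= t0 <-] lt] := @inf_adherent _ _ e e0
  (_ : has_inf [set p (x + t *: y) - t * p y | t in [set t | 0 <= t]]).
  split; first by exists (p (x + 0 *: y) - 0 * p y); exists 0 => //=.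
  by exists (- p (- x)); exact: shear_lbound.
by exists t.
Qed.

Lemma shear_sublinear p y : sublinear_on p -> S y -> sublinear_on (shear p y).
Proof.
move=> sp Sy; split=> [u v Su Sv|a u a0 Su].
  apply/ler_addgt0Pr => e e0; have e20 : 0 < e / 2 by rewrite divr_gt0.
  have [s s0 lts] := shear_adherent sp Sy Su e20.
  have [t t0 ltt] := shear_adherent sp Sy Sv e20.
  have := shear_le sp Sy (SD Su Sv) (addr_ge0 s0 t0).
  have := sp.1 _ _ (SD Su (SZ s Sy)) (SD Sv (SZ t Sy)).
  by rewrite addrACA -scalerDl; lra.
(* One inequality is enough: its instance at [a^-1] and [a *: u] is the converse. *)
suff le b w : 0 < b -> S w -> shear p y (b *: w) <= b * shear p y w.
  apply/eqP; rewrite eq_le le//=.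
  have := le a^-1 (a *: u) ltac:(by rewrite invr_gt0) (SZ a Su).
  by rewrite scalerA mulVf ?gt_eqF// scale1r ler_pdivlMl.
move=> b0 Sw; apply/ler_addgt0Pr => e e0.
have [t t0 lt] := shear_adherent sp Sy Sw (divr_gt0 e0 b0).
have := shear_le sp Sy (SZ b Sw) (mulr_ge0 (ltW b0) t0).
rewrite -scalerA -scalerDr sp.2//; last by apply: SD => //; exact: SZ.
have := ltW lt; rewrite -(ler_pM2l b0) !mulrDr mulrCA divff ?gt_eqF//; lra.
Qed.

(* A sublinear functional that is minimal below [p] is additive: otherwise
   [shear] would produce a smaller one. *)
Lemma sublinear_minimal_additive p : sublinear_on p ->
  exists q, [/\ sublinear_on q, forall u, S u -> q u <= p u &
    forall u v, S u -> S v -> q (u + v) = q u + q v].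
Proof.
move=> sp.
pose Q := {q | sublinear_on q /\ forall u, S u -> q u <= p u}.
(* The order is reversed, so Zorn's maximal element is a minimal functional. It is only a preorder,
   since values outside [S] are not compared. *)
pose rel (q1 q2 : Q) := `[< forall u, S u -> sval q2 u <= sval q1 u >].
have p_in : sublinear_on p /\ forall u, S u -> p u <= p u by [].
have relxx q : rel q q by apply/asboolP.
have reltr q1 q2 q3 : rel q1 q2 -> rel q2 q3 -> rel q1 q3.
  move=> /asboolP h1 /asboolP h2; apply/asboolP => u Su.
  exact: le_trans (h2 u Su) (h1 u Su).
have [|[q [sq qp]] qmin] := ZL_preorder (exist _ p p_in : Q) relxx reltr.
  (* A nonempty chain is bounded by its pointwise infimum, the empty one by [p]. *)
  move=> A totA; have [[q0 Aq0]|A0] := pselect (A !=set0); last first.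
    by exists (exist _ p p_in) => q Aq; exfalso; apply: A0; exists q.
  pose E u := [set sval q u | q in A].
  have lbE u : S u -> lbound (E u) (- p (- u)).
    move=> Su _ [q Aq <-]; have := sublinear_onN (svalP q).1 Su.
    by apply: le_trans; rewrite lerN2; exact: (svalP q).2 _ (SN Su).
  have infE u : S u -> has_inf (E u).
    move=> Su; split; first by exists (sval q0 u); exists q0.
    by exists (- p (- u)); exact: lbE.
  have inf_le u q : S u -> A q -> inf (E u) <= sval q u.
    by move=> Su Aq; apply: ge_inf; [exact: (infE _ Su).2|exists q].
  have inf_adh u e : S u -> 0 < e ->
      exists2 q, A q & sval q u < inf (E u) + e.
    by move=> Su e0; have [_ [q Aq <-] lt] := inf_adherent e0 (infE _ Su);
       exists q.
  have sr : sublinear_on (fun u => inf (E u)).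
    split=> [u v Su Sv|a u a0 Su].
      apply/ler_addgt0Pr => e e0; have e20 : 0 < e / 2 by rewrite divr_gt0.
      have [q1 Aq1 lt1] := inf_adh _ _ Su e20.
      have [q2 Aq2 lt2] := inf_adh _ _ Sv e20.
      (* Near-minimizers at [u] and at [v] may differ; the smaller of the two in the chain serves
         both points. *)
      have [q Aq [le1 le2]] : exists2 q, A q &
          sval q u <= sval q1 u /\ sval q v <= sval q2 v.
        have [/asboolP h|/asboolP h] := totA _ _ Aq1 Aq2.
          by exists q2 => //; split=> //; exact: h.
        by exists q1 => //; split=> //; exact: h.
      have := inf_le _ _ (SD Su Sv) Aq; have := (svalP q).1.1 _ _ Su Sv; lra.
    suff le b w : 0 < b -> S w -> inf (E (b *: w)) <= b * inf (E w).
      apply/eqP; rewrite eq_le le//=.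
      have := le a^-1 (a *: u) ltac:(by rewrite invr_gt0) (SZ a Su).
      by rewrite scalerA mulVf ?gt_eqF// scale1r ler_pdivlMl.
    move=> b0 Sw; apply/ler_addgt0Pr => e e0.
    have [q Aq lt] := inf_adh _ _ Sw (divr_gt0 e0 b0).
    have := inf_le _ _ (SZ b Sw) Aq; rewrite (svalP q).1.2//.
    have := ltW lt; rewrite -(ler_pM2l b0) mulrDr mulrCA divff ?gt_eqF//; lra.
  have rp u : S u -> inf (E u) <= p u.
    by move=> Su; exact: le_trans (inf_le _ _ Su Aq0) ((svalP q0).2 _ Su).
  have r_in := conj sr rp.
  exists (exist _ (fun u => inf (E u)) r_in : Q) => q Aq; apply/asboolP => u Su.
  exact: inf_le.
exists q; split=> // u v Su Sv; apply/eqP; rewrite eq_le sq.1//=.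
have sv_le w : S w -> shear q v w <= q w.
  by move=> Sw; have := shear_le sq Sv Sw (lexx 0);
     rewrite scale0r addr0 mul0r subr0.
have sh_in : sublinear_on (shear q v) /\ forall w, S w -> shear q v w <= p w.
  split; first exact: shear_sublinear.
  by move=> w Sw; exact: le_trans (sv_le _ Sw) (qp _ Sw).
(* Minimality gives [q u <= shear q v u], which [t = 1] bounds by [q (u + v) - q v]. *)
have /asboolP/(_ u Su) /= := qmin (exist _ (shear q v) sh_in : Q)
  ltac:(by apply/asboolP => w Sw; exact: sv_le).
have := shear_le sq Sv Su ler01; rewrite scale1r mul1r; lra.
Qed.

(** Minimizing below [shear p v] instead of [p] pins the value at [v]. *)
Lemma hahn_banach_at p v : sublinear_on p -> S v ->
  exists q, [/\ sublinear_on q,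
    forall u w, S u -> S w -> q (u + w) = q u + q w,
    forall u, S u -> q u <= p u & q v = p v].
Proof.
move=> sp Sv.
have [q [sq qp qD]] := sublinear_minimal_additive (shear_sublinear sp Sv).
have sv_le w : S w -> shear p v w <= p w.
  by move=> Sw; have := shear_le sp Sv Sw (lexx 0);
     rewrite scale0r addr0 mul0r subr0.
have qle u : S u -> q u <= p u.
  by move=> Su; exact: le_trans (qp _ Su) (sv_le _ Su).
exists q; split=> //; apply/eqP; rewrite eq_le qle//=.
have := shear_le sp Sv (SN Sv) ler01.
rewrite scale1r mul1r addNr (sublinear_on0 sp Sv).
have := qp _ (SN Sv); have := qD _ _ Sv (SN Sv).
by rewrite subrr (sublinear_on0 sq Sv); lra.
Qed.

End sublinear.

(** * Tightness *)

Section borel.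
Context {R : realType}.

Lemma open_borel (T : ptopologicalType) (U : set T) :
  open U -> measurable (U : set (borel T)).
Proof. by move=> oU; apply: sub_sigma_algebra. Qed.

Lemma closed_borel (T : ptopologicalType) (F : set T) :
  closed F -> measurable (F : set (borel T)).
Proof.
by move=> cF; rewrite -(setCK F); apply: measurableC; apply: open_borel;
   exact: closed_openC.
Qed.

Lemma continuous_borel (T : ptopologicalType) (f : T -> R) : continuous f ->
  measurable_fun setT (f : borel T -> R).
Proof.
move=> /continuousP cf; apply: (measurability _ (RGenOpens.measurableE R)).
move=> _ [_ [a [b ->]] <-]; rewrite setTI; apply: open_borel.
exact/cf/interval_open.
Qed.

(** The balls of radius [n.+1%:R^-1] around a dense sequence that fit in a compact set cover the
    space. Finite unions of these compact sets increase to everything, and [mu] is continuous from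
    below. *)
Lemma locally_compact_tight (X : pmetricType R) (mu : probability (borel X) R)
    (e : R) : separable X -> locally_compact [set: X] -> 0 < e ->
  exists2 K : set X, compact K & (mu (~` K) <= e%:E)%E.
Proof.
move=> [D cD dD] lcX e0.
have /pcard_surjP[d surjd] := cD.
pose r (n : nat) : R := n.+1%:R^-1.
have r0 n : 0 < r n by rewrite invr_gt0.
(* [C p] is required to contain the ball coded by [p] only if some compact set does. *)
have /choice[C CP] : forall p : nat * nat, exists C : set X, compact C /\
    ((exists2 K, compact K & ball (d p.1) (r p.2) `<=` K) ->
     ball (d p.1) (r p.2) `<=` C).
  move=> p; have [[K cK bK]|h] :=
    pselect (exists2 K, compact K & ball (d p.1) (r p.2) `<=` K).
    by exists K.
  by exists set0; split => //; exact: compact0.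
pose F n := if unpickle n is Some p then C p else set0.
have cF n : compact (F n).
  by rewrite /F; case: unpickle => [p|]; [exact: (CP p).1|exact: compact0].
pose G n := \big[setU/set0]_(i < n.+1) F i.
have cG n : compact (G n) by apply: bigsetU_compact.
have mG n : measurable (G n : set (borel X)).
  by apply: closed_borel; apply: compact_closed => //; exact: metric_hausdorff.
have GT : \bigcup_n G n = setT.
  rewrite bigcup_bigsetU_bigcup; apply/seteqP; split=> // x _.
  have [//|U nU [cU _]] := @lcX x; rewrite withinET in nU.
  have /nbhs_ballP[_/posnumP[q] qU] := nU.
  near \oo => n.
  (* With half the radius, the ball around a dense point close to [x] still lies in the compact
     neighbourhood [U]. *)
  have rq : r n < q%:num / 2.
    by near: n; apply: (near_infty_natSinv_lt (PosNum _)).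
  have [y [yx Dy]] := dD (ball x (r n))° ltac:(by exists x; exact: nbhsx_ballx)
    (open_interior _).
  have [m _ dm] := surjd _ Dy.
  exists (pickle (m, n)) => //; rewrite /F pickleK.
  apply: (CP (m, n)).2 => /=; last first.
    by rewrite dm; apply: ball_sym; exact: interior_subset yx.
  exists U => //; apply: subset_trans qU => z; rewrite dm => yz.
  have := ball_triangle (interior_subset yx) yz.
  by apply: le_ball; lra.
have ndG : nondecreasing_seq G.
  by move=> m n mn; apply/subsetPset; exact: subset_bigsetU.
have muG := @nondecreasing_cvg_mu _ _ _ mu _ mG (bigcupT_measurable _ mG) ndG.
have {}muG : (mu \o G) @ \oo --> 1%E.
  have muT : mu (\bigcup_n G n) = 1%E by rewrite GT; exact: probability_setT.
  by rewrite -muT.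
have : \forall n \near \oo, ((1 - e)%:E < mu (G n))%E.
  by apply: (muG [set y | ((1 - e)%:E < y)%E]);
    apply: open_ereal_gt'; rewrite lte_fin; lra.
case=> n _ /(_ n (leqnn n)) /= lt; exists (G n) => //.
rewrite probability_setC//; move: lt.
rewrite -(fineK (fin_num_measure mu _ (mG n))) -EFinB lte_fin lee_fin; lra.
Unshelve. all: by end_near. Qed.

End borel.

(** * From a tight finitely additive set function to a measure *)

Section inner_content.
Context {R : realType} {T : ptopologicalType} (nu : set T -> R).
Hypothesis T2 : hausdorff_space T.
Hypothesis T3 : @regular_space T.
Hypothesis nu_ge0 : forall A, 0 <= nu A.
Hypothesis nuU : forall A B, A `&` B = set0 -> nu (A `|` B) = nu A + nu B.
Hypothesis nuT : nu setT = 1.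
Hypothesis nu_tight :
  forall e, 0 < e -> exists2 K, compact K & nu (~` K) <= e.

Local Open Scope ereal_scope.

Let nu0 : nu set0 = 0%R.
Proof. by have := @nuU set0 set0; rewrite setU0 setI0 => /(_ erefl); lra. Qed.

Let nuID A B : nu A = (nu (A `&` B) + nu (A `\` B))%R.
Proof. by rewrite -nuU ?setUIDK// setDE setIACA setICr setI0. Qed.

Let le_nu A B : A `<=` B -> (nu A <= nu B)%R.
Proof. by move=> AB; rewrite (nuID B A) (setIidr AB) lerDl. Qed.

Let nu_setU A B : (nu (A `|` B) <= nu A + nu B)%R.
Proof.
rewrite (nuID _ A) setUK lerD2l; apply: le_nu.
by move=> x [[//|//]].
Qed.

(** Approximation by compact sets gives countable subadditivity on open sets, which [nu] itself may
    lack. *)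
Definition inner (U : set T) : \bar R :=
  ereal_sup [set (nu K)%:E | K in [set K | compact K /\ K `<=` U]].

Definition outer (A : set T) : \bar R :=
  ereal_inf [set inner U | U in [set U | open U /\ A `<=` U]].

Lemma compact_le_inner K U : compact K -> K `<=` U -> (nu K)%:E <= inner U.
Proof. by move=> cK KU; apply: ereal_sup_ubound; exists K. Qed.

Lemma inner_le U : inner U <= (nu U)%:E.
Proof. by apply: ge_ereal_sup => _ [K [_ KU] <-]; rewrite lee_fin le_nu. Qed.

Lemma inner_ge0 U : 0 <= inner U.
Proof.
by apply: le_trans (compact_le_inner (@compact0 _) (@sub0set _ U)); rewrite nu0.
Qed.

Lemma inner_mono U V : U `<=` V -> inner U <= inner V.
Proof.
move=> UV; apply: ge_ereal_sup => _ [K [cK KU] <-].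
exact: compact_le_inner (subset_trans KU UV).
Qed.

(** Regularity puts around each point of [K] a neighbourhood whose closure stays in some [U n].
    Finitely many of them cover [K], and grouping them by index yields compact sets [C n] inside
    [U n], to which finite subadditivity of [nu] applies. *)
Lemma inner_bigcup (U : (set T)^nat) : (forall n, open (U n)) ->
  inner (\bigcup_n U n) <= \sum_(n <oo) inner (U n).
Proof.
move=> oU; apply: ge_ereal_sup => _ [K [cK KU] <-].
have /choice[n_ n_P] x : exists n, K x -> U n x.
  have [Kx|nKx] := pselect (K x); last by exists 0%N.
  by have [n _ Unx] := KU _ Kx; exists n.
have /choice[W WP] x : exists W, K x -> nbhs x W /\ closure W `<=` U (n_ x).
  have [Kx|nKx] := pselect (K x); last by exists set0.
  have /T3 : nbhs x (U (n_ x)) by apply: open_nbhs_nbhs; split=> //; exact: n_P.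
  by case=> W nW WU; exists W.
have := cK; rewrite compact_cover => /(_ T K (fun x => (W x)°)) [].
- by move=> x _; exact: open_interior.
- by move=> x Kx; exists x => //; exact: (WP x Kx).1.
move=> D DK KD.
pose C n := \big[setU/set0]_(x <- finmap.enum_fset D | n_ x == n)
  (K `&` closure (W x)).
have CE n : C n =
  \bigcup_(x in [set x | (x \in finmap.enum_fset D) && (n_ x == n)])
    (K `&` closure (W x)) by rewrite bigcup_seq_cond.
have cC n : compact (C n).
  apply: bigsetU_compact => x _; rewrite setIC.
  apply: (@subclosed_compact _ _ K) => //.
  by apply: closedI; [exact: closed_closure|exact: compact_closed T2 cK].
have CU n : C n `<=` U n.
  rewrite CE => y [x /= /andP[xD /eqP <-] [_ Wy]].
  by apply: (WP x _).2 => //; have := DK _ xD; rewrite inE.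
(* [N] exceeds every index occurring in the finite cover. *)
pose N := (\max_(x <- finmap.enum_fset D) (n_ x).+1)%N.
have KC : K `<=` \big[setU/set0]_(n < N) C n.
  move=> y Ky; have [x /= xD Wy] := KD _ Ky.
  rewrite -bigcup_mkord; exists (n_ x) => /=.
    by rewrite /N (leq_trans _ (leq_bigmax_seq _ xD isT)).
  rewrite CE; exists x; first by rewrite /= eqxx andbT.
  by split => //; apply: subset_closure; exact: interior_subset.
apply: (@le_trans _ _ (\sum_(0 <= n < N) inner (U n))); last first.
  by apply: nneseries_lim_ge => // *; exact: inner_ge0.
apply: (@le_trans _ _ (nu (\big[setU/set0]_(n < N) C n))%:E).
  by rewrite lee_fin le_nu.
elim: N {KC} => [|N ih]; first by rewrite big_ord0 big_nil nu0.
rewrite big_ord_recr big_nat_recr//=.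
apply: (@le_trans _ _ (nu (\big[setU/set0]_(n < N) C n) + nu (C N))%:E).
  by rewrite lee_fin nu_setU.
by rewrite EFinD leeD// compact_le_inner.
Qed.

Lemma outer_open U : open U -> outer U = inner U.
Proof.
move=> oU; apply/eqP; rewrite eq_le; apply/andP; split.
  by apply: ereal_inf_lbound; exists U => //; split.
by apply: le_ereal_inf_tmp => _ [V [_ UV] <-]; exact: inner_mono.
Qed.

Lemma outer_ge0 A : 0 <= outer A.
Proof. by apply: le_ereal_inf_tmp => _ [V _ <-]; exact: inner_ge0. Qed.

Lemma outer_le1 A : outer A <= 1.
Proof.
apply: le_trans (_ : inner setT <= _); last by rewrite -nuT inner_le.
by apply: ereal_inf_lbound; exists setT => //; split => //; exact: openT.
Qed.

Lemma outer_fin_num A : outer A \is a fin_num.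
Proof.
rewrite ge0_fin_numE ?outer_ge0//.
by rewrite (le_lt_trans (outer_le1 A))// ltry.
Qed.

Lemma le_outer A B : A `<=` B -> outer A <= outer B.
Proof.
move=> AB; apply: ereal_inf_le_tmp => _ [V [oV BV] <-].
by exists V => //; split=> //; exact: subset_trans BV.
Qed.

Lemma outer0 : outer set0 = 0.
Proof.
apply/eqP; rewrite eq_le outer_ge0 andbT outer_open; last exact: open0.
by rewrite (le_trans (inner_le _))// nu0.
Qed.

Lemma outer_sigma_subadditive : sigma_subadditive outer.
Proof.
move=> A; apply/lee_addgt0Pr => e e0.
apply: le_trans (epsilon_trick _ _ (ltW e0)); last by move=> n; exact: outer_ge0.
have /choice[U UP] n : exists U, [/\ open U, A n `<=` U &
    inner U <= outer (A n) + (e / (2 ^ n.+1)%:R)%:E].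
  have en : (0 < e / (2 ^ n.+1)%:R)%R by rewrite divr_gt0// ltr0n expn_gt0.
  have [_ [U [oU AU] <-] lt] := lb_ereal_inf_adherent en (outer_fin_num (A n)).
  by exists U; split => //; exact: ltW.
apply: (@le_trans _ _ (inner (\bigcup_n U n))).
  apply: ereal_inf_lbound; exists (\bigcup_n U n) => //; split.
    by apply: bigcup_open => n _; have [] := UP n.
  by apply: subset_bigcup => n _; have [] := UP n.
apply: le_trans (inner_bigcup _) _; first by move=> n; have [] := UP n.
apply: lee_nneseries => [n _ _|n _]; first exact: inner_ge0.
by have [] := UP n.
Qed.

HB.instance Definition _ := isOuterMeasure.Build R T outer
  outer0 outer_ge0 le_outer outer_sigma_subadditive.

(** Given an open [V] containing [A], exhaust the part of [V] in [U] by a compact [K], then [V]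
    minus [K], which contains the part of [V] outside [U], by a compact [L]. The two are disjoint
    and their union is a compact subset of [V], so additivity of [nu] gives the splitting. *)
Lemma open_caratheodory U : open U -> outer.-caratheodory U.
Proof.
move=> oU; apply: (@le_caratheodory_measurable _ _ outer) => A.
apply: le_ereal_inf_tmp => _ [V [oV AV] <-].
apply: (@le_trans _ _ (inner (V `&` U) + outer (V `&` ~` U))).
  apply: leeD; last by apply: le_outer; exact: setSI.
  by rewrite -outer_open; [apply: le_outer; exact: setSI|exact: openI].
rewrite -leeBrDr ?outer_fin_num//; apply: ge_ereal_sup => _ [K [cK KVU] <-].
rewrite leeBrDr ?outer_fin_num// addeC -leeBrDr//.
have oVK : open (V `&` ~` K).
  by apply: openI => //; apply: closed_openC; exact: compact_closed.
apply: (@le_trans _ _ (inner (V `&` ~` K))).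
  rewrite -outer_open//; apply: le_outer => x [Vx nUx]; split => // Kx.
  by apply: nUx; have [] := KVU _ Kx.
apply: ge_ereal_sup => _ [L [cL LVK] <-].
rewrite leeBrDr// -EFinD -nuU; last first.
  by apply/seteqP; split => // x [/LVK[]].
apply: compact_le_inner; first exact: compactU.
by move=> x [/LVK[]//|/KVU[]].
Qed.

(** The same function, typed on the Borel sigma-algebra rather than on the Caratheodory one. *)
Let bouter : set (borel T) -> \bar R := outer.

Let borel_caratheodory (A : set (borel T)) : measurable A ->
  (measurable : set (set (caratheodory_type outer))) A.
Proof.
apply: smallest_sub => [|U oU]; last exact: open_caratheodory.
split; first exact: measurable0.
  by move=> B mB; rewrite setTD; exact: measurableC.
by move=> B mB; exact: bigcupT_measurable.
Qed.

Let bouter_sigma_additive : semi_sigma_additive bouter.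
Proof.
move=> F mF tF mUF; apply: (@caratheodory_measure_sigma_additive R T outer) => //.
  by move=> i; exact: borel_caratheodory.
exact: borel_caratheodory.
Qed.

HB.instance Definition _ := isMeasure.Build _ _ _ bouter
  outer0 outer_ge0 bouter_sigma_additive.

(** Tightness prevents a loss of mass: [inner setT] is at least [nu K], which is at least
    [1 - e]. *)
Let bouterT : bouter setT = 1.
Proof.
apply/eqP; rewrite eq_le outer_le1/=.
apply/lee_addgt0Pr => e e0; have [K cK nuK] := nu_tight e0.
have := compact_le_inner cK (@subsetT _ K).
rewrite /bouter outer_open; last exact: openT.
move=> /(leeD2r e%:E); apply: le_trans; rewrite -EFinD lee_fin.
by move: (nuID setT K); rewrite setTI setTD nuT; lra.
Qed.

HB.instance Definition _ := Measure_isProbability.Build _ _ _ bouter bouterT.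

Lemma inner_regular_probability :
  exists pi : probability (borel T) R, forall U, open U -> pi U <= (nu U)%:E.
Proof.
exists bouter => U oU; rewrite [leLHS]outer_open//.
exact: inner_le.
Qed.

End inner_content.

(** * Means *)

Definition ubounded {R : realType} {T : Type} : set (T -> R) :=
  [set h | exists M, forall x, `|h x| <= M].

Section ubounded.
Context {R : realType} {T : Type}.
Implicit Types h : T -> R.

Lemma uboundedD h1 h2 : ubounded h1 -> ubounded h2 -> ubounded (h1 + h2).
Proof.
move=> [M1 hM1] [M2 hM2]; exists (M1 + M2) => x.
by rewrite (le_trans (ler_normD _ _))// lerD.
Qed.

Lemma uboundedZ a h : ubounded h -> ubounded (a *: h).
Proof.
by move=> [M hM]; exists (`|a| * M) => x; rewrite /= normrM ler_wpM2l.
Qed.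

Lemma ubounded_cst a : ubounded (cst a : T -> R).
Proof. by exists `|a|. Qed.

Lemma ubounded_indic (A : set T) : ubounded (\1_A : T -> R).
Proof. by exists 1 => x; rewrite indicE normr_nat lern1; case: (_ \in _). Qed.

Lemma ubounded_sum I (s : seq I) (h : I -> T -> R) :
  (forall i, ubounded (h i)) -> ubounded (\sum_(i <- s) h i).
Proof.
move=> bh; apply: (big_ind ubounded) => //.
  exact: (ubounded_cst 0).
by move=> *; exact: uboundedD.
Qed.

Lemma bounded_funE h : bounded_fun h <-> ubounded h.
Proof.
split=> [[M [_ hM]]|[M hM]].
  by exists (M + 1) => x; apply: (hM (M + 1)) => //; rewrite ltrDl.
exists M; split; first exact: num_real.
by move=> N MN x _; exact: le_trans (hM x) (ltW MN).
Qed.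

End ubounded.

Section expectation.
Context {R : realType} d {T : measurableType d} (mu : probability T R).

Definition bmeasurable : set (T -> R) :=
  [set f | measurable_fun setT f /\ ubounded f].

Lemma bmeasurable_integrable f : bmeasurable f ->
  mu.-integrable setT (EFin \o f).
Proof.
move=> [mf bf]; apply: measurable_bounded_integrable => //.
  by rewrite (@le_lt_trans _ _ 1%E) ?probability_le1// ltry.
exact/bounded_funE.
Qed.

Lemma bmeasurable_cst a : bmeasurable (cst a).
Proof. by split; [exact: measurable_cst|exact: ubounded_cst]. Qed.

Lemma bmeasurableD f g : bmeasurable f -> bmeasurable g -> bmeasurable (f + g).
Proof.
by move=> [mf bf] [mg bg]; split; [exact: measurable_funD|exact: uboundedD].
Qed.

Lemma bmeasurableZ a f : bmeasurable f -> bmeasurable (a *: f).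
Proof.
move=> [mf bf]; split; last exact: uboundedZ.
by apply: measurable_funM => //; exact: measurable_cst.
Qed.

Lemma bmeasurable_indic (A : set T) : measurable A -> bmeasurable \1_A.
Proof.
by move=> mA; split; [exact: measurable_indic|exact: ubounded_indic].
Qed.

Lemma bmeasurable_sum I (s : seq I) (h : I -> T -> R) :
  (forall i, bmeasurable (h i)) -> bmeasurable (\sum_(i <- s) h i).
Proof.
move=> bh; apply: (big_ind bmeasurable) => //.
  exact: (bmeasurable_cst 0).
by move=> *; exact: bmeasurableD.
Qed.

Definition mean (f : T -> R) : R := \int[mu]_x f x.

Lemma meanE f : bmeasurable f -> (\int[mu]_x (f x)%:E)%E = (mean f)%:E.
Proof.
by move=> bf; rewrite fineK//; exact/integrable_fin_num/bmeasurable_integrable.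
Qed.

Lemma mean_cst a : mean (cst a) = a.
Proof. by rewrite /mean Rintegral_cst//= [X in fine X]probability_setT mulr1. Qed.

Lemma meanD f g : bmeasurable f -> bmeasurable g ->
  mean (f + g) = mean f + mean g.
Proof.
by move=> bf bg; apply: RintegralD => //; exact: bmeasurable_integrable.
Qed.

Lemma meanZ a f : bmeasurable f -> mean (a *: f) = a * mean f.
Proof. by move=> bf; apply: RintegralZl => //; exact: bmeasurable_integrable. Qed.

Lemma le_mean f g : bmeasurable f -> bmeasurable g ->
  (forall x, f x <= g x) -> mean f <= mean g.
Proof.
by move=> bf bg fg; apply: le_Rintegral => //; exact: bmeasurable_integrable.
Qed.

Lemma mean_indic (A : set T) : measurable A -> (mean \1_A)%:E = mu A.
Proof.
move=> mA; rewrite -meanE; last exact: bmeasurable_indic.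
by rewrite integral_indic// setIT.
Qed.

Lemma mean_sum I (s : seq I) (h : I -> T -> R) :
  (forall i, bmeasurable (h i)) ->
  mean (\sum_(i <- s) h i) = \sum_(i <- s) mean (h i).
Proof.
move=> bh; elim: s => [|i s ih]; first by rewrite !big_nil (mean_cst 0).
by rewrite !big_cons meanD ?ih//; exact: bmeasurable_sum.
Qed.

End expectation.

(** Domination by a sublinear functional yields upper bounds and positive homogeneity, hence these
    fields; signs and monotonicity follow in [fameanN] and [le_famean]. *)
Record finitely_additive_mean {R : realType} {T : Type} (L : (T -> R) -> R)
    : Prop := FinitelyAdditiveMean {
  fameanD : forall f g, ubounded f -> ubounded g -> L (f + g) = L f + L g ;
  fameanZ : forall a f, 0 < a -> ubounded f -> L (a *: f) = a * L f ;
  famean_le0 : forall f, ubounded f -> (forall x, f x <= 0) -> L f <= 0 ;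
  famean1 : L (cst 1) = 1 }.

Section finitely_additive_mean.
Context {R : realType} {T : Type} (L : (T -> R) -> R).
Hypothesis meanL : finitely_additive_mean L.

Let LD := fameanD meanL.
Let LZ := fameanZ meanL.
Let L_le0 := famean_le0 meanL.
Let L1 := famean1 meanL.

Lemma famean0 : L (cst 0) = 0.
Proof.
have := LD (ubounded_cst 0) (ubounded_cst 0).
by rewrite (_ : cst 0 + cst 0 = cst 0)//=;
   [lra|apply/funext => x /=; exact: addr0].
Qed.

Lemma fameanN f : ubounded f -> L (- f) = - L f.
Proof.
move=> bf; have bNf : ubounded (- f) by rewrite -scaleN1r; exact: uboundedZ.
by have := LD bf bNf; rewrite subrr famean0; lra.
Qed.

Lemma le_famean f g : ubounded f -> ubounded g -> (forall x, f x <= g x) ->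
  L f <= L g.
Proof.
move=> bf bg fg; have bfg : ubounded (f - g).
  by apply: uboundedD => //; rewrite -scaleN1r; exact: uboundedZ.
rewrite -[f](subrK g) LD// gerDr; apply: L_le0 => // x.
by rewrite subr_le0.
Qed.

Lemma famean_cst a : L (cst a) = a.
Proof.
have pos b : 0 < b -> L (cst b) = b.
  move=> b0; rewrite (_ : cst b = b *: cst 1); last first.
    by apply/funext => x /=; exact: (esym (mulr1 b)).
  by rewrite LZ ?L1 ?mulr1//; exact: ubounded_cst.
have [a0|a0|->] := ltgtP a 0; [|exact: pos|exact: famean0].
rewrite (_ : cst a = - cst (- a)); last first.
  by apply/funext => x /=; rewrite -[RHS]/(- - a) opprK.
by rewrite fameanN ?pos ?oppr_gt0 ?opprK//; exact: ubounded_cst.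
Qed.

Lemma famean_sum I (s : seq I) (h : I -> T -> R) :
  (forall i, ubounded (h i)) ->
  L (\sum_(i <- s) h i) = \sum_(i <- s) L (h i).
Proof.
move=> bh; elim: s => [|i s ih]; first by rewrite !big_nil famean0.
by rewrite !big_cons LD ?ih//; exact: ubounded_sum.
Qed.

Lemma famean_indic_ge0 (A : set T) : 0 <= L \1_A.
Proof.
rewrite -famean0; apply: le_famean.
- exact: ubounded_cst.
- exact: ubounded_indic.
- by move=> x; rewrite indicE.
Qed.

Lemma famean_indicU (A B : set T) : A `&` B = set0 ->
  L \1_(A `|` B) = L \1_A + L \1_B.
Proof.
move=> AB0; rewrite -LD; [|exact: ubounded_indic|exact: ubounded_indic].
congr L; apply/funext => x; rewrite fctE !indicE in_setU.
have : ~ ((x \in A) && (x \in B)).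
  by rewrite -in_setI AB0 in_set0.
by case: (x \in A) (x \in B) => -[]//= _; rewrite ?addr0 ?add0r.
Qed.

Lemma famean_indicT : L \1_setT = 1.
Proof. by rewrite indicT. Qed.

End finitely_additive_mean.

(** * Layer cake comparison of a measure with a finitely additive mean *)

Section layer_cake.
Context {R : realType}.

(** For [0 < t <= N%:R * r] this rounds [t] up to a multiple of [r]. The strict inequality makes the
    level sets of a continuous function open. *)
Definition staircase (r : R) (N : nat) (t : R) : R :=
  \sum_(j < N) r * (j%:R * r < t)%R%:R.

Lemma staircase_ge r N t : 0 < r -> t <= N%:R * r -> t <= staircase r N t.
Proof.
(* Capping [t] at [N%:R * r] makes the statement inductive. *)
move=> r0; suff : Num.min t (N%:R * r) <= staircase r N t.
  by move=> + tN; rewrite min_l.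
rewrite /staircase; elim: N => [|N ih].
  by rewrite mul0r big_ord0 ge_min lexx orbT.
rewrite big_ord_recr/= -natr1 mulrDl mul1r.
have [tN|Nt] := leP t (N%:R * r).
  by move: ih; rewrite min_l// mulr0 addr0 => ih; rewrite min_l//; lra.
by move: ih; rewrite min_r ?(ltW Nt)// mulr1 => ih; rewrite ge_min lerD2r ih orbT.
Qed.

Lemma staircase_le r N t : 0 < r -> 0 <= t -> staircase r N t <= t + r.
Proof.
(* The second bound feeds the induction when the new step is counted. *)
move=> r0 t0; suff : staircase r N t <= t + r /\ staircase r N t <= N%:R * r.
  by case.
rewrite /staircase; elim: N => [|N [ih1 ih2]].
  by rewrite mul0r big_ord0 lexx; split => //; lra.
rewrite big_ord_recr/= -natr1 mulrDl mul1r.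
by have [tN|Nt] := leP t (N%:R * r); rewrite ?mulr0 ?mulr1; split; lra.
Qed.

(** Once [c] is shifted to be nonnegative, its staircase exceeds it by at most [r] and is a positive
    combination of indicators of open sets, on which [pi] is below [L]. *)
Lemma layer_cake_le (T : ptopologicalType) (pi : probability (borel T) R)
    (L : (T -> R) -> R) (c : T -> R) :
  finitely_additive_mean L ->
  (forall U, open U -> (pi U <= (L \1_U)%:E)%E) ->
  continuous c -> ubounded c -> mean pi c <= L c.
Proof.
move=> meanL piL cc bc; have [M cM] := bc.
pose c1 := c + cst M.
have bc1 : ubounded c1 by apply: uboundedD => //; exact: ubounded_cst.
have cc1 : continuous c1.
  by move=> x; apply: continuousD; [exact: cc|exact: cst_continuous].
have c1_ge0 x : 0 <= c1 x by have := cM x; rewrite ler_norml /c1 /= fctE/=; lra.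
have c1_le x : c1 x <= 2 * M.
  by have := cM x; rewrite ler_norml /c1 /= fctE/=; lra.
have bmc : bmeasurable (c : borel T -> R) by split => //; exact: continuous_borel.
have bmc1 : bmeasurable (c1 : borel T -> R) by split => //;
  exact: continuous_borel.
suff : mean pi c1 <= L c1.
  rewrite meanD//; last exact: bmeasurable_cst.
  by rewrite (fameanD meanL)//;
     [rewrite mean_cst famean_cst//; lra|exact: ubounded_cst].
apply/ler_addgt0Pr => r r0.
(* The grid of mesh [r] has to reach the upper bound [2 * M] of [c1]. *)
have [N MN] : exists N : nat, 2 * M <= N%:R * r.
  exists (Num.truncn (2 * M / r)).+1; rewrite -ler_pdivrMr//.
  by apply/ltW; exact: truncnS_gt.
pose A (j : nat) : set T := [set x | j%:R * r < c1 x].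
have oA j : open (A j).
  rewrite (_ : A j = c1 @^-1` [set t | j%:R * r < t])//.
  by move/continuousP : cc1; apply; exact: open_gt.
have bA j : ubounded (r *: \1_(A j) : T -> R).
  by apply: uboundedZ; exact: ubounded_indic.
have bmA j : bmeasurable (r *: \1_(A j) : borel T -> R).
  by apply: bmeasurableZ; apply: bmeasurable_indic; exact: open_borel.
pose s : T -> R := \sum_(j < N) r *: \1_(A j).
have sE x : s x = staircase r N (c1 x).
  rewrite /s /staircase fct_sumE; apply: eq_bigr => j _.
  rewrite -[LHS]/(r * \1_(A j) x) indicE; congr (_ * _%:R); congr nat_of_bool.
  by apply/idP/idP; rewrite inE.
have bs : ubounded s by exact: ubounded_sum.
have bms : bmeasurable (s : borel T -> R) by exact: bmeasurable_sum.
apply: (@le_trans _ _ (mean pi s)).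
  apply: le_mean => // x; rewrite sE.
  by apply: staircase_ge => //; exact: le_trans MN.
apply: (@le_trans _ _ (L s)).
  rewrite /s mean_sum// famean_sum//; apply: ler_sum => j _.
  rewrite meanZ; last by apply: bmeasurable_indic; exact: open_borel.
  rewrite (fameanZ meanL)//; last exact: ubounded_indic.
  rewrite ler_pM2l// -lee_fin mean_indic; last exact: open_borel.
  exact: piL.
rewrite -(famean_cst meanL r) -(fameanD meanL)//; last exact: ubounded_cst.
apply: le_famean => //; first by apply: uboundedD => //; exact: ubounded_cst.
by move=> x; rewrite sE; exact: staircase_le.
Qed.

End layer_cake.

(** * The finitely additive problem *)

Section transport.
Context {R : realType} {k : nat} (X : 'I_k -> pmetricType R).
Context (mu : forall i, probability (borel (X i)) R).

Definition oplus (g : forall i, X i -> R) (x : prod_topology X) : R :=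
  \sum_(i < k) g i (x i).

Definition bmeasurable_family : set (forall i, X i -> R) :=
  [set g | forall i, bmeasurable (g i : borel (X i) -> R)].

Definition total_mean (g : forall i, X i -> R) : R :=
  \sum_(i < k) mean (mu i) (g i).

Lemma mean_adherent d (T : measurableType d) (P : probability T R) f e :
  bmeasurable f -> 0 < e -> exists x, f x <= mean P f + e.
Proof.
move=> bf e0; apply: contrapT => /forallNP nf.
have := @le_mean _ _ _ P (cst (mean P f + e)) f (bmeasurable_cst _) bf.
rewrite mean_cst => /(_ _) h; suff : mean P f + e <= mean P f by lra.
by apply: h => x; have /negP := nf x; rewrite -ltNge => /ltW.
Qed.

(** Points where each [g i] is at most its mean, up to a small error, combine into one point of the
    product, where the hypothesis is evaluated. *)
Lemma total_mean_ge g a : bmeasurable_family g ->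
  (forall x, a <= oplus g x) -> a <= total_mean g.
Proof.
move=> bg ag; apply/ler_addgt0Pr => e e0.
(* [k.+1] is nonzero for every [k], and the [k] errors still add up to at most [e]. *)
have r0 : 0 < e / k.+1%:R by rewrite divr_gt0.
have /all_sig[x xP] i : {x : X i | g i x <= mean (mu i) (g i) + e / k.+1%:R}.
  by apply: cid; exact: (@mean_adherent _ _ (mu i) _ _ (bg i) r0).
apply: le_trans (ag x) _.
apply: (@le_trans _ _ (\sum_(i < k) (mean (mu i) (g i) + e / k.+1%:R))).
  by apply: ler_sum => i _; exact: xP.
rewrite big_split/= lerD2l sumr_const card_ord -[leLHS]mulr_natr.
by rewrite -mulrA ler_piMr ?(ltW e0)// ler_pdivrMl// mulr1 ler_nat.
Qed.

(* The means dominated by this sublinear functional are exactly the finitely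
   additive couplings of the [mu i]. *)
Definition marginal_sup (h : prod_topology X -> R) : R :=
  inf [set total_mean g |
       g in [set g | bmeasurable_family g /\ forall x, h x <= oplus g x]].

Hypothesis k_gt0 : (0 < k)%N.

Lemma marginal_sup_has_inf h : ubounded h -> has_inf [set total_mean g |
  g in [set g | bmeasurable_family g /\ forall x, h x <= oplus g x]].
Proof.
move=> [M hM]; split; last first.
  exists (- M) => _ [g [bg hg] <-]; apply: total_mean_ge => // x.
  by apply: le_trans (hg x); have := hM x; rewrite ler_norml => /andP[].
(* The bound [M] is split evenly; with no factor, [oplus g] would be zero and could not majorize a
   positive [h]. *)
pose g i : X i -> R := cst (M / k%:R).
exists (total_mean g); exists g => //; split.
  by move=> i; exact: bmeasurable_cst.
move=> x; rewrite /oplus /g /= sumr_const card_ord -[leRHS]mulr_natr divfK.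
  by have := hM x; rewrite ler_norml => /andP[].
by rewrite pnatr_eq0 -lt0n.
Qed.

Lemma marginal_sup_le h g : ubounded h -> bmeasurable_family g ->
  (forall x, h x <= oplus g x) -> marginal_sup h <= total_mean g.
Proof.
by move=> bh bg hg; apply: ge_inf; [exact: (marginal_sup_has_inf bh).2|exists g].
Qed.

Lemma marginal_sup_adherent h e : ubounded h -> 0 < e -> exists g,
  [/\ bmeasurable_family g, forall x, h x <= oplus g x &
      total_mean g < marginal_sup h + e].
Proof.
move=> bh e0; have [_ [g [bg hg] <-] lt] :=
  inf_adherent e0 (marginal_sup_has_inf bh).
by exists g.
Qed.

Lemma marginal_sup_sublinear : sublinear_on ubounded marginal_sup.
Proof.
split=> [u v bu bv|a u a0 bu].
  apply/ler_addgt0Pr => e e0; have e20 : 0 < e / 2 by rewrite divr_gt0.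
  have [g [bg ug ltg]] := marginal_sup_adherent bu e20.
  have [h [bh vh lth]] := marginal_sup_adherent bv e20.
  have bgh : bmeasurable_family (fun i => g i + h i).
    by move=> i; exact: bmeasurableD.
  have le : marginal_sup (u + v) <= total_mean (fun i => g i + h i).
    apply: marginal_sup_le => //; first exact: uboundedD.
    by move=> x; rewrite /oplus big_split; apply: lerD; [exact: ug|exact: vh].
  apply: le_trans le _; rewrite /total_mean.
  under eq_bigr do rewrite meanD//.
  rewrite big_split/=; move: ltg lth; rewrite /total_mean; lra.
suff le b w : 0 < b -> ubounded w -> marginal_sup (b *: w) <= b * marginal_sup w.
  apply/eqP; rewrite eq_le le//=.
  have := le a^-1 (a *: u) ltac:(by rewrite invr_gt0) (uboundedZ a bu).
  by rewrite scalerA mulVf ?gt_eqF// scale1r ler_pdivlMl.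
move=> b0 bw; apply/ler_addgt0Pr => e e0.
have [g [bg wg ltg]] := marginal_sup_adherent bw (divr_gt0 e0 b0).
have le : marginal_sup (b *: w) <= total_mean (fun i => b *: g i).
  apply: marginal_sup_le; first exact: uboundedZ.
    by move=> i; exact: bmeasurableZ.
  by move=> x; rewrite /oplus -mulr_sumr; apply: ler_wpM2l;
     [exact: ltW|exact: wg].
apply: le_trans le _; rewrite /total_mean.
under eq_bigr do rewrite meanZ//.
rewrite -mulr_sumr; move: (ltW ltg); rewrite -(ler_pM2l b0) mulrDr.
by rewrite mulrCA divff ?gt_eqF// mulr1 /total_mean.
Qed.

Lemma marginal_sup_le_mean i (f : X i -> R) (h : prod_topology X -> R) :
  ubounded h -> bmeasurable (f : borel (X i) -> R) ->
  (forall x, h x <= f (x i)) -> marginal_sup h <= mean (mu i) f.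
Proof.
move=> bh bf hf; pose g := dfwith (fun j => cst 0 : X j -> R) i f.
(* Stated for arbitrary [G], as it serves both for means and for evaluation at a point. *)
have sum_g (G : forall j, (X j -> R) -> R) : (forall j, G j (cst 0) = 0) ->
    \sum_(j < k) G j (g j) = G i f.
  move=> G0; rewrite (bigD1 i)//= /g dfwithin big1 ?addr0// => j ji.
  by rewrite dfwithout 1?eq_sym.
have <- : total_mean g = mean (mu i) f.
  by apply: (sum_g (fun j => mean (mu j))) => j; exact: mean_cst.
apply: marginal_sup_le => //.
  move=> j; have [<-|ij] := eqVneq i j; first by rewrite /g dfwithin.
    by rewrite /g dfwithout//; exact: bmeasurable_cst.
by move=> x; rewrite /oplus (sum_g (fun j u => u (x j))).
Qed.

(** Hahn-Banach is applied at [- c], so [L c = - marginal_sup (- c)] is the supremum of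
    [total_mean g] over bounded Borel families with [oplus g] below [c]. The marginal bounds come
    from majorants of a single coordinate. *)
Lemma marginal_mean_exists (c : prod_topology X -> R) : ubounded c ->
  exists L : (prod_topology X -> R) -> R,
  [/\ finitely_additive_mean L,
     (forall i A, measurable (A : set (borel (X i))) ->
       ((L \1_[set x | A (x i)])%:E <= mu i A)%E) &
     (forall e, 0 < e -> exists g, [/\ bmeasurable_family g,
       forall x, oplus g x <= c x & L c <= total_mean g + e])].
Proof.
move=> bc; have bNc : ubounded (- c) by rewrite -scaleN1r; exact: uboundedZ.
have [L [[_ LZ] LD Lp LNc]] :=
  hahn_banach_at (@uboundedD _ _) (@uboundedZ _ _) marginal_sup_sublinear bNc.
have Lle a f : ubounded f -> (forall x, f x <= a) -> L f <= a.
  move=> bf fa; apply: le_trans (Lp _ bf) _.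
  rewrite -[leRHS](mean_cst (mu (Ordinal k_gt0))).
  by apply: marginal_sup_le_mean => //; exact: bmeasurable_cst.
have L_ge1 : 1 <= L (cst 1).
  have b1 : ubounded (- cst 1 : prod_topology X -> R).
    by rewrite -scaleN1r; apply: uboundedZ; exact: ubounded_cst.
  have L0 : L (cst 0) = 0.
    have b0 : ubounded (cst 0 : prod_topology X -> R) by exact: ubounded_cst.
    by have := LD _ _ b0 b0; rewrite -[cst 0 + _]/(0 + cst 0) add0r; lra.
  have := LD _ _ (ubounded_cst 1) b1; rewrite subrr.
  by rewrite -[0]/(cst 0) L0; have := Lle (-1) _ b1 (fun=> lexx _); lra.
have meanL : finitely_additive_mean L.
  split => //; first by move=> f bf f0; exact: Lle.
  by apply/eqP; rewrite eq_le L_ge1 Lle//; exact: ubounded_cst.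
exists L; split => //.
- move=> i A mA; rewrite -mean_indic// lee_fin.
  apply: le_trans (Lp _ (ubounded_indic _)) _.
  apply: marginal_sup_le_mean; first exact: ubounded_indic.
    exact: bmeasurable_indic.
  by move=> x; rewrite !indicE.
- move=> e e0; have [g [bg cg ltg]] := marginal_sup_adherent bNc e0.
  (* A change of sign turns a majorant of [- c] into a minorant of [c]. *)
  exists (fun i => -1 *: g i); split.
  + by move=> i; exact: bmeasurableZ.
  + move=> x; rewrite /oplus -mulr_sumr mulN1r lerNl; exact: cg.
  + have -> : total_mean (fun i => -1 *: g i) = - total_mean g.
      by rewrite /total_mean; under eq_bigr do rewrite meanZ//;
         rewrite -mulr_sumr mulN1r.
    by move: ltg; rewrite -LNc (fameanN meanL)//; lra.
Qed.

End transport.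

(** * Attainment in the dual problem *)

Section sums_and_suprema.
Context {R : realType}.

Lemma cvg_sumr (I : Type) (W : Type) (F : set_system W) {FF : Filter F}
    (s : seq I) (u : I -> W -> R) (l : I -> R) :
  (forall i, u i w @[w --> F] --> l i) ->
  (\sum_(i <- s) u i w) @[w --> F] --> \sum_(i <- s) l i.
Proof.
move=> ul; elim: s => [|i s ih].
  by rewrite big_nil; under eq_fun do rewrite big_nil; exact: cvg_cst.
by rewrite big_cons; under eq_fun do rewrite big_cons; exact: cvgD.
Qed.

(** Near-suprema can be chosen independently for each [i], with errors adding up to at most [e]. *)
Lemma sum_sup_le k (A : 'I_k -> set R) (M : R) : (forall i, has_sup (A i)) ->
  (forall a : 'I_k -> R, (forall i, A i (a i)) -> \sum_(i < k) a i <= M) ->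
  \sum_(i < k) sup (A i) <= M.
Proof.
move=> supA sumA; apply/ler_addgt0Pr => e e0.
have r0 : 0 < e / k.+1%:R by rewrite divr_gt0.
have /choice[a aP] i : exists a, A i a /\ sup (A i) - e / k.+1%:R < a.
  by have [a Aa lt] := sup_adherent r0 (supA i); exists a.
apply: (@le_trans _ _ (\sum_(i < k) (a i + e / k.+1%:R))).
  by apply: ler_sum => i _; rewrite -lerBlDr; apply/ltW; exact: (aP i).2.
rewrite big_split/=; apply: lerD; first by apply: sumA => i; exact: (aP i).1.
rewrite sumr_const card_ord -[leLHS]mulr_natr.
by rewrite -mulrA ler_piMr ?(ltW e0)// ler_pdivrMl// mulr1 ler_nat.
Qed.

End sums_and_suprema.

(** * Lipschitz envelopes of bounded functions *)

Section lipschitz_envelope.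
Context {R : realType} {X : pmetricType R} (L : R) (h : X -> R).

(* The [l^1] product metric makes replacing every [f i] by its envelope
   compatible with the constraint, without iterating c-transforms. *)
Definition lipschitz_envelope (x : X) : R :=
  sup (range (fun y => h y - L * mdist x y)).

Hypothesis L_ge0 : 0 <= L.
Hypothesis bh : ubounded h.

Lemma lipschitz_envelope_has_sup x :
  has_sup (range (fun y => h y - L * mdist x y)).
Proof.
have [M hM] := bh; split; first by exists (h x - L * mdist x x); exists x.
exists M => _ [y _ <-]; have := hM y; rewrite ler_norml => /andP[_ hy].
by rewrite lerBlDr (le_trans hy)// lerDl mulr_ge0// mdist_ge0.
Qed.

Lemma lipschitz_envelope_ge x y : h y - L * mdist x y <= lipschitz_envelope x.
Proof.
by apply: sup_ubound; [exact: (lipschitz_envelope_has_sup x).2|exists y].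
Qed.

Lemma lipschitz_envelope_lip x y :
  lipschitz_envelope x <= lipschitz_envelope y + L * mdist x y.
Proof.
apply: ge_sup; first exact: (lipschitz_envelope_has_sup x).1.
move=> _ [z _ <-]; have := lipschitz_envelope_ge y z.
have := ler_wpM2l L_ge0 (metric_triangle y x z); rewrite (metric_sym y x); lra.
Qed.

Lemma lipschitz_envelope_le M : (forall x, h x <= M) ->
  forall x, lipschitz_envelope x <= M.
Proof.
move=> hM x; apply: ge_sup; first exact: (lipschitz_envelope_has_sup x).1.
move=> _ [y _ <-]; rewrite lerBlDr (le_trans (hM y))// lerDl.
by rewrite mulr_ge0// mdist_ge0.
Qed.

End lipschitz_envelope.

(** * Continuity of the mean on equi-Lipschitz, uniformly bounded functions *)

Section lipschitz_limits.
Context {R : realType} {X : pmetricType R} (mu : probability (borel X) R).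

(** The one-sided form passes directly to suprema and pointwise limits; exchanging [x] and [y] gives
    the absolute value. *)
Definition lipschitz_with (L : R) (f : X -> R) :=
  forall x y, f x <= f y + L * mdist x y.

Lemma lipschitz_with_continuous L f : 0 <= L -> lipschitz_with L f ->
  continuous f.
Proof.
move=> L0 lipf x; apply/cvgrPdist_le => e e0.
(* [L + 1] is positive even when [L] is zero. *)
have r0 : 0 < e / (L + 1) by rewrite divr_gt0// ltr_wpDl.
apply/nbhs_ballP; exists (e / (L + 1)) => // y /=; rewrite ballEmdist/= => xy.
have Lxy : L * mdist x y <= e.
  rewrite (@le_trans _ _ ((L + 1) * mdist x y))//.
    by rewrite ler_wpM2r ?mdist_ge0// lerDl.
  by rewrite -ler_pdivlMl ?ltr_wpDl// mulrC ltW.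
have := lipf x y; have := lipf y x; rewrite (metric_sym y x) ler_norml; lra.
Qed.

(** Integration of the pointwise bound of [u] by [v + r] plus [B] times the indicator of the
    complement of [K]. *)
Lemma le_mean_compact (K : set X) u v r B : compact K ->
  bmeasurable (u : borel X -> R) -> bmeasurable (v : borel X -> R) ->
  0 <= r -> 0 <= B ->
  (forall x, K x -> u x <= v x + r) -> (forall x, u x <= v x + B) ->
  mean mu u <= mean mu v + r + B * fine (mu (~` K)).
Proof.
move=> cK bu bv r0 B0 uK uB.
have mK : measurable (~` K : set (borel X)).
  apply: measurableC; apply: closed_borel; apply: compact_closed => //.
  exact: metric_hausdorff.
have b1 := @bmeasurable_indic R _ _ _ mK.
rewrite -(@mean_cst _ _ _ mu r) -[fine _]/(fine (mu (~` K))) -mean_indic//=.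
rewrite -meanZ// -meanD//; last exact: bmeasurable_cst.
rewrite -meanD//; [|apply: bmeasurableD => //; exact: bmeasurable_cst|
  exact: bmeasurableZ].
apply: le_mean => //.
  apply: bmeasurableD; [|exact: bmeasurableZ].
  by apply: bmeasurableD => //; exact: bmeasurable_cst.
move=> x; rewrite !fctE /= -[_ *: _]/(B * _) indicE.
have [Kx|nKx] := pselect (K x).
  by rewrite memNset ?mulr0 ?addr0 ?uK//; exact.
by rewrite mem_set// mulr1; have := uB x; lra.
Qed.

(** Under a common Lipschitz constant, pointwise convergence is uniform on a compact set carrying
    almost all the mass; the uniform bound controls the rest. This works along any proper filter,
    whereas dominated convergence is sequential. *)
Lemma lipschitz_mean_cvg (W : Type) (F : set_system W) {FF : ProperFilter F}
    (L M : R) (f_ : W -> X -> R) (f : X -> R) :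
  separable X -> locally_compact [set: X] -> 0 <= L ->
  (\forall w \near F, lipschitz_with L (f_ w) /\ forall x, `|f_ w x| <= M) ->
  lipschitz_with L f -> (forall x, `|f x| <= M) ->
  (forall x, f_ w x @[w --> F] --> f x) ->
  mean mu (f_ w) @[w --> F] --> mean mu f.
Proof.
move=> sepX lcX L0 f_P lipf fM f_f.
have M0 : 0 <= M by exact: le_trans (fM point).
have bm u : lipschitz_with L u -> (forall x, `|u x| <= M) ->
    bmeasurable (u : borel X -> R).
  move=> lipu uM; split; last by exists M.
  by apply: continuous_borel; exact: lipschitz_with_continuous lipu.
apply/cvgrPdist_le => e e0.
(* Off [K] the functions differ by at most [2 * M], so this much mass costs at most [e / 2]; the
   added 1 covers [M = 0]. *)
have B0 : 0 < e / 2 / (2 * M + 1) by rewrite !divr_gt0// ltr_wpDl// mulr_ge0.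
have [K cK muK] := locally_compact_tight mu sepX lcX B0.
have mK : measurable (~` K : set (borel X)).
  apply: measurableC; apply: closed_borel; apply: compact_closed => //.
  exact: metric_hausdorff.
have {}muK : 2 * M * fine (mu (~` K)) <= e / 2.
  have : fine (mu (~` K)) <= e / 2 / (2 * M + 1).
    by rewrite -lee_fin fineK//; exact: fin_num_measure.
  rewrite ler_pdivlMr ?ltr_wpDl ?mulr_ge0//; apply: le_trans.
  rewrite mulrC ler_wpM2l ?fine_ge0// lerDl//.
(* The near-covering form of compactness turns an estimate local in both [x] and [w] into one
   uniform on [K]. *)
have near_le : \forall w \near F, K `<=` [set x | `|f x - f_ w x| <= e / 2].
  have /compact_near_coveringP/(_ _ F
    (fun w x => `|f x - f_ w x| <= e / 2)) := cK; apply => x Kx.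
  (* Three errors of [e / 6]: moving from [y] to [x] in [f], passing from [f] to [f_ w] at [x], and
     moving back in [f_ w]. *)
  have r0 : 0 < e / 6 by rewrite divr_gt0.
  have d0 : 0 < e / 6 / (L + 1) by rewrite divr_gt0// ltr_wpDl.
  near=> y w.
  have [lipw _] : lipschitz_with L (f_ w) /\ forall x, `|f_ w x| <= M.
    by near: w.
  have : mdist x y < e / 6 / (L + 1).
    near: y; apply/nbhs_ballP; exists (e / 6 / (L + 1)) => // y.
    by rewrite ballEmdist.
  rewrite ltr_pdivlMr ?ltr_wpDl// => xy.
  have Lxy : L * mdist x y <= e / 6.
    by apply: le_trans (ltW xy); rewrite mulrC ler_wpM2l ?mdist_ge0// lerDl.
  have : `|f x - f_ w x| <= e / 6.
    by near: w; move/cvgrPdist_le : (f_f x); apply.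
  have := lipf x y; have := lipf y x; have := lipw x y; have := lipw y x.
  rewrite (metric_sym y x) !ler_norml; lra.
near=> w.
have [lipw wM] : lipschitz_with L (f_ w) /\ forall x, `|f_ w x| <= M.
  by near: w.
have wK : K `<=` [set x | `|f x - f_ w x| <= e / 2] by near: w.
have e2 : 0 <= e / 2 by rewrite divr_ge0// ltW.
have M2 : 0 <= 2 * M by rewrite mulr_ge0.
rewrite ler_norml; apply/andP; split.
- suff : mean mu (f_ w) <= mean mu f + e / 2 + 2 * M * fine (mu (~` K)) by lra.
  apply: le_mean_compact => //; [exact: bm lipw wM|exact: bm lipf fM| |] => x;
    last by have := fM x; have := wM x; rewrite !ler_norml; lra.
  by move=> /wK /=; rewrite ler_norml; lra.
- suff : mean mu f <= mean mu (f_ w) + e / 2 + 2 * M * fine (mu (~` K)) by lra.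
  apply: le_mean_compact => //; [exact: bm lipf fM|exact: bm lipw wM| |] => x;
    last by have := fM x; have := wM x; rewrite !ler_norml; lra.
  by move=> /wK /=; rewrite ler_norml; lra.
Unshelve. all: by end_near. Qed.

End lipschitz_limits.

(** * A pointwise compact class of dual competitors *)

Section dual.
Context {R : realType} {k : nat} (X : 'I_k -> pmetricType R).
Context (mu : forall i, probability (borel (X i)) R).
Context (c : prod_topology X -> R) (M L : R).
Hypothesis k_gt0 : (0 < k)%N.
Hypothesis cM : forall x, `|c x| <= M.
Hypothesis L_ge0 : 0 <= L.
Hypothesis c_lip : forall x y, `|c x - c y| <= L * prod_mdist x y.

Definition dual_class : set (forall i, X i -> R) :=
  [set f | (forall i, lipschitz_with L (f i) /\ forall x, `|f i x| <= 2 * M) /\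
           forall x, oplus f x <= c x].

Let M_ge0 : 0 <= M.
Proof. exact: le_trans (cM point). Qed.

Lemma dual_class_bmeasurable f : dual_class f -> bmeasurable_family f.
Proof.
move=> [fP _] i; have [lipf fM] := fP i; split; last by exists (2 * M).
by apply: continuous_borel; exact: lipschitz_with_continuous lipf.
Qed.

(** For independently chosen [y i], the penalties add up to [L * prod_mdist x y], exactly what the
    Lipschitz bound on [c] pays to pass from [c y] to [c x]. *)
Lemma lipschitz_envelope_oplus_le (h : forall i, X i -> R) :
  (forall i, ubounded (h i)) -> (forall x, oplus h x <= c x) ->
  forall x, oplus (fun i => lipschitz_envelope L (h i)) x <= c x.
Proof.
move=> bh hc x; apply: sum_sup_le => [i|a aP].
  exact: lipschitz_envelope_has_sup.
have /all_sig[y yP] i : {y : X i | h i y - L * mdist (x i) y = a i}.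
  by apply: cid; have [y _ <-] := aP i; exists y.
rewrite -(eq_bigr _ (fun i _ => yP i)) sumrB -mulr_sumr.
have := hc y; have := c_lip x y; rewrite /oplus /prod_mdist ler_norml; lra.
Qed.

(* Shifting the [g i] by constants that add up to zero makes all their suprema
   equal, hence at most [M / k]; truncating below at [- 2 * M] then keeps the
   constraint, since a truncated term already brings the sum below [- M]. *)
Lemma shift_truncate (g : forall i, X i -> R) :
  (forall i, ubounded (g i)) -> (forall x, oplus g x <= c x) ->
  exists (a : 'I_k -> R) (h : forall i, X i -> R),
  [/\ \sum_(i < k) a i = 0, forall i x, g i x + a i <= h i x,
      forall i x, `|h i x| <= 2 * M & forall x, oplus h x <= c x].
Proof.
move=> bg gc; pose s i := sup (range (g i)).
have supg i : has_sup (range (g i)).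
  split; first by exists (g i point); exists point.
  have [B gB] := bg i; exists B => _ [x _ <-].
  by have := gB x; rewrite ler_norml => /andP[].
pose S := \sum_(i < k) s i.
have SM : S <= M.
  apply: sum_sup_le => // b bP.
  have /all_sig[y yP] i : {y : X i | g i y = b i}.
    by apply: cid; have [y _ <-] := bP i; exists y.
  rewrite -(eq_bigr _ (fun i _ => yP i)).
  by have := gc y; have := cM y; rewrite /oplus ler_norml; lra.
have k0 : 0 < k%:R :> R by rewrite ltr0n.
have k1 : 1 <= k%:R :> R by rewrite ler1n.
have MkM : M / k%:R <= M by rewrite ler_pdivrMr// ler_peMr.
have Mk0 : 0 <= M / k%:R by rewrite divr_ge0// ltW.
have sum_cst b : \sum_(i < k) b / k%:R = b :> R.
  by rewrite sumr_const card_ord -[LHS]mulr_natr divfK// gt_eqF.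
pose a i := S / k%:R - s i.
have ga i x : g i x + a i <= M / k%:R.
  have : g i x <= s i by apply: sup_ubound; [exact: (supg i).2|exists x].
  have : S / k%:R <= M / k%:R by rewrite ler_pM2r// invr_gt0.
  rewrite /a; lra.
pose h i x := Num.max (g i x + a i) (- (2 * M)).
have hM i x : h i x <= M / k%:R by rewrite ge_max ga; lra.
have sa : \sum_(i < k) a i = 0 by rewrite sumrB sum_cst subrr.
exists a, h; split => //.
- by move=> i x; rewrite le_max lexx.
- move=> i x; rewrite ler_norml; apply/andP; split.
    by rewrite le_max lexx orbT.
  by have := hM i x; lra.
move=> x; have [[i lti]|nlt] :=
    pselect (exists i, g i (x i) + a i < - (2 * M)).
  apply: (@le_trans _ _ (- M)); last first.
    by have := cM x; rewrite ler_norml => /andP[].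
  (* Subtracting [M / k%:R] from each term makes all of them nonpositive; the truncated one is then
     at most [- (2 * M)], and restoring [M] leaves at most [- M]. *)
  rewrite /oplus -[leLHS](subrK M) -[X in _ - X + _](sum_cst M) -sumrB.
  rewrite (bigD1 i)//=.
  have : \sum_(j < k | j != i) (h j (x j) - M / k%:R) <= 0.
    by apply: sumr_le0 => j _; rewrite subr_le0.
  have -> : h i (x i) = - (2 * M) by rewrite /h max_r// ltW.
  lra.
have -> : oplus h x = oplus g x; last exact: gc.
rewrite -[RHS]addr0 -sa /oplus -big_split/=; apply: eq_bigr => i _.
by rewrite /h max_l// leNgt; apply/negP => lt; apply: nlt; exists i.
Qed.

(** Each [g i + a i] lies below [h i], which lies below its envelope, and the shifts [a i] cancel in
    the total. *)
Lemma dual_class_improve g : bmeasurable_family g ->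
  (forall x, oplus g x <= c x) ->
  exists2 f, dual_class f & total_mean mu g <= total_mean mu f.
Proof.
move=> bg gc.
have [a [h [sa gh hM hc]]] := shift_truncate (fun i => (bg i).2) gc.
have bh i : ubounded (h i) by exists (2 * M).
pose f i := lipschitz_envelope L (h i).
have hf i x : h i x <= f i x.
  by have := lipschitz_envelope_ge L_ge0 (bh i) x x; rewrite mdistxx mulr0 subr0.
have df : dual_class f.
  split; last exact: lipschitz_envelope_oplus_le.
  move=> i; split; first by move=> x y; exact: lipschitz_envelope_lip.
  move=> x; rewrite ler_norml; apply/andP; split.
    by apply: le_trans (hf i x); have := hM i x; rewrite ler_norml => /andP[].
  apply: lipschitz_envelope_le => // y.
  by have := hM i y; rewrite ler_norml => /andP[].
exists f => //; rewrite -[leLHS]addr0 -sa /total_mean -big_split/=.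
apply: ler_sum => i _; rewrite -[a i](mean_cst (mu i)).
rewrite -meanD; [|exact: bg|exact: bmeasurable_cst].
apply: le_mean.
- apply: bmeasurableD; first exact: bg.
  exact: bmeasurable_cst.
- exact: (dual_class_bmeasurable df).
- by move=> x; exact: le_trans (gh i x) (hf i x).
Qed.

Lemma dual_class_max : (forall i, separable (X i)) ->
  (forall i, locally_compact [set: X i]) -> dual_class !=set0 ->
  exists2 f, dual_class f &
    forall g, dual_class g -> total_mean mu g <= total_mean mu f.
Proof.
move=> sepX lcX [f0 df0].
pose E := [set total_mean mu f | f in dual_class].
have supE : has_sup E.
  split; first by exists (total_mean mu f0); exists f0.
  exists (\sum_(i < k) 2 * M) => _ [f df <-]; apply: ler_sum => i _.
  rewrite -(mean_cst (mu i) (2 * M)); apply: le_mean.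
  - exact: dual_class_bmeasurable.
  - exact: bmeasurable_cst.
  - by move=> x /=; have := (df.1 i).2 x; rewrite ler_norml => /andP[].
have /choice[f_ f_P] n : exists f, dual_class f /\
    sup E - n.+1%:R^-1 < total_mean mu f.
  have n0 : 0 < n.+1%:R^-1 :> R by rewrite invr_gt0.
  by have [_ [f df <-] lt] := sup_adherent n0 supE; exists f.
(* Over the disjoint union of the spaces, a family of functions is a single point of a product of
   segments, compact by Tychonoff. *)
pose I : eqType := {i : 'I_k & X i}.
pose Y := prod_topology (fun _ : I => R).
pose K := [set q : Y | forall p, [set` `[- (2 * M), 2 * M]] (q p)].
have cK : compact K.
  apply: (@tychonoff I (fun=> R) (fun=> [set` `[- (2 * M), 2 * M]])) => p.
  exact: segment_compact.
pose fam (q : Y) i x := q (existT _ i x).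
pose phi n : Y := fun p => f_ n (projT1 p) (projT2 p).
have phiK : (phi @ \oo) K.
  exists 0%N => // n _ p /=; rewrite in_itv/= -ler_norml.
  exact: ((f_P n).1.1 (projT1 p)).2.
have [q [Kq]] := cK _ _ phiK.
(* In place of a subsequence, [G] is a filter converging to [q] and containing every set that
   eventually holds along the maximizing sequence. *)
rewrite cluster_cvgE => -[G PG [Gq phiG]].
have Gp i x : fam w i x @[w --> G] --> fam q i x.
  have := @proj_continuous I (fun=> R) (existT _ i x) q.
  by apply: cvg_trans; exact: (cvg_app _ Gq).
have Gclass : \forall w \near G, dual_class (fam w).
  by apply: phiG; exists 0%N => // n _; exact: (f_P n).1.
have lipq i : lipschitz_with L (fam q i).
  move=> x y; apply: (ler_cvg_to (Gp i x)
    (cvgD (Gp i y) (cvg_cst (L * mdist x y)))).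
  by apply: filterS Gclass => w [wP _]; exact: (wP i).1.
have qM i x : `|fam q i x| <= 2 * M.
  by have /= := Kq (existT _ i x); rewrite in_itv/= -ler_norml.
exists (fam q).
  split=> [i|x]; first by split.
  have Gx : oplus (fam w) x @[w --> G] --> oplus (fam q) x.
    by apply: cvg_sumr => i; exact: Gp.
  by apply: (cvgr_to_le Gx); apply: filterS Gclass => w [].
move=> g dg; apply: (@le_trans _ _ (sup E)).
  by apply: sup_ubound; [exact: supE.2|exists g].
have Gmean : total_mean mu (fam w) @[w --> G] --> total_mean mu (fam q).
  apply: cvg_sumr => i; apply: (@lipschitz_mean_cvg _ _ _ _ _ _ L (2 * M)) => //.
  by apply: filterS Gclass => w [wP _]; exact: wP.
apply/ler_addgt0Pr => e e0; rewrite -lerBlDr.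
(* This eventual lower bound transfers to [G], and from there to the limit [fam q]. *)
have fsup : \forall n \near \oo, sup E - e <= total_mean mu (f_ n).
  near=> n; apply: (@le_trans _ _ (sup E - n.+1%:R^-1)); last first.
    exact: ltW (f_P n).2.
  by rewrite lerB// ltW//; near: n; exact: (near_infty_natSinv_lt (PosNum e0)).
by apply: (cvgr_to_ge Gmean); exact: phiG fsup.
Unshelve. all: by end_near. Qed.

End dual.

(** * Couplings *)

(** A closed set is the intersection of its decreasing open neighbourhoods, so the inequality
    extends to closed sets. Complements reverse it on open sets, which are stable under intersection
    and generate the Borel sets. *)
Lemma probability_le_open_eq (R : realType) (X : pmetricType R)
    (P Q : probability (borel X) R) :
  (forall U : set X, open U -> (P U <= Q U)%E) ->
  forall A, measurable A -> P A = Q A.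
Proof.
move=> PQ; have PQ_closed (F : set X) : closed F -> (P F <= Q F)%E.
  move=> cF; pose G n := \bigcup_(y in F) (ball y (n.+1%:R^-1 : R))°.
  have oG n : open (G n) by apply: bigcup_open => y _; exact: open_interior.
  have mG n : measurable (G n : set (borel X)) by exact: open_borel.
  have GF : \bigcap_n G n = F.
    apply/seteqP; split=> [x Gx|x Fx n _]; last first.
      by exists x => //; apply: nbhsx_ballx; rewrite invr_gt0.
    apply: contrapT => nFx.
    have /nbhs_ballP[_/posnumP[e] eF] : nbhs x (~` F).
      by apply: open_nbhs_nbhs; split => //; exact: closed_openC.
    near \oo => n; have [y Fy /interior_subset yx] := Gx n I.
    apply: (eF y) => //; apply: ball_sym; apply: le_ball yx.
    by apply/ltW; near: n; exact: near_infty_natSinv_lt.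
  have niG : nonincreasing_seq G.
    move=> m n mn; apply/subsetPset => x [y Fy xy]; exists y => //.
    move: x xy; apply: interiorS; apply: le_ball.
    by rewrite lef_pV2 ?posrE// ler_nat.
  have fin (S : probability (borel X) R) : (S (G 0%N) < +oo)%E.
    by rewrite (le_lt_trans (probability_le1 _ (mG 0%N)))// ltry.
  have mI : measurable (\bigcap_n G n : set (borel X)).
    by apply: bigcapT_measurable.
  have cP := nonincreasing_cvg_mu (fin P) mG mI niG.
  have cQ := nonincreasing_cvg_mu (fin Q) mG mI niG.
  rewrite GF in cP cQ.
  rewrite -(cvg_lim _ cP)// -(cvg_lim _ cQ)//; apply: lee_lim.
  - by apply/cvg_ex; eexists; exact: cP.
  - by apply/cvg_ex; eexists; exact: cQ.
  - by apply: nearW => n; exact: PQ.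
have PQ_open (U : set X) : open U -> P U = Q U.
  move=> oU; apply/eqP; rewrite eq_le PQ//=.
  have := PQ_closed (~` U) (open_closedC oU).
  have mU : measurable (U : set (borel X)) by exact: open_borel.
  rewrite !probability_setC//.
  rewrite -(fineK (fin_num_measure P _ mU)) -(fineK (fin_num_measure Q _ mU)).
  by rewrite -!EFinB !lee_fin; lra.
apply: (@measure_unique _ R (borel X) (@open X) (fun=> setT)) => //.
- by move=> A B; exact: openI.
- by move=> _; exact: openT.
- by apply/seteqP; split => // x _; exists 0%N.
- by move=> _; rewrite (le_lt_trans (probability_le1 _ measurableT))// ltry.
Unshelve. all: by end_near. Qed.

Section coupling.
Context {R : realType} {k : nat} (X : 'I_k -> pmetricType R).
Context (mu : forall i, probability (borel (X i)) R).
Local Notation T := (prod_topology X).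

(* The library does not combine the pointed and the topological structure of
   [prod_topology], and [ptopologicalType] needs both. *)
HB.instance Definition _ := Pointed.on T.

(** [prod_mdist] does not define the topology of [prod_topology X], so continuity goes through the
    projections: each of the finitely many distances tends to zero. *)
Lemma prod_lipschitz_continuous (c : T -> R) : prod_lipschitz c -> continuous c.
Proof.
move=> [L cL] x; have FF : ProperFilter (nbhs (x : T)) by exact: nbhs_pfilter.
have mdist_cvg i : mdist (x i) (y i) @[y --> nbhs (x : T)] --> (0 : R).
  apply/cvgrPdist_lt => e e0.
  have xi : \forall z \near x i, mdist (x i) z < e.
    by apply/nbhs_ballP; exists e => // z; rewrite ballEmdist.
  have : \forall y \near nbhs (x : T), mdist (x i) (y i) < e.
    exact: (@proj_continuous _ X i x _ xi).
  apply: (@filterS _ (nbhs (x : T)) FF) => y /= xy.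
  by rewrite sub0r normrN ger0_norm// mdist_ge0.
have Lcvg : L * prod_mdist x y @[y --> nbhs (x : T)] --> (0 : R).
  rewrite -(mulr0 L) -(_ : \sum_(i < k) 0 = 0 :> R); last by rewrite big1.
  by apply: cvgM; [exact: cvg_cst|exact: cvg_sumr].
apply/cvgrPdist_le => e e0; move/cvgr_le : Lcvg => /(_ e e0).
by move=> H; apply: filterS H => y; exact: le_trans.
Qed.

Lemma open_proj_preimage i (U : set (X i)) : open U ->
  open [set x : T | U (x i)].
Proof.
move=> oU; have cproj := @proj_continuous _ X i.
exact: (@open_comp T (X i) (@proj _ X i) U (fun x _ => cproj x) oU).
Qed.

Lemma measurable_proj i :
  measurable_fun setT (fun x : borel T => x i : borel (X i)).
Proof.
apply: (@measurability _ _ _ _ _ (fun x : borel T => x i : borel (X i))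
  (@open (X i))) => //.
move=> _ [U oU <-]; rewrite setTI; apply: sub_sigma_algebra.
exact: open_proj_preimage.
Qed.

Lemma bmeasurable_coord i (f : X i -> R) : bmeasurable (f : borel (X i) -> R) ->
  bmeasurable (fun x : borel T => f (x i)).
Proof.
move=> [mf [M fM]]; split; last by exists M => x; exact: fM.
exact: (measurableT_comp mf (@measurable_proj i)).
Qed.

Lemma oplusE (f : forall i, X i -> R) :
  oplus f = \sum_(i < k) (fun x : T => f i (x i)).
Proof. by apply/funext => x; rewrite fct_sumE. Qed.

Lemma bmeasurable_oplus f : bmeasurable_family f ->
  bmeasurable (oplus f : borel T -> R).
Proof.
move=> bf; rewrite oplusE; apply: bmeasurable_sum => i.
exact: bmeasurable_coord (bf i).
Qed.

Lemma coupling_mean (pi : probability (borel T) R) (f : forall i, X i -> R) :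
  couplings mu pi -> bmeasurable_family f ->
  mean pi (oplus f) = total_mean mu f.
Proof.
move=> cpl bf; have bfi i := bmeasurable_coord (bf i); rewrite oplusE.
rewrite mean_sum//; apply: eq_bigr => i _.
rewrite /mean /Rintegral; congr fine.
have mf : measurable_fun setT (EFin \o (f i : borel (X i) -> R)).
  by apply/measurable_EFinP; exact: (bf i).1.
have := @integral_pushforward _ _ _ _ _ _ (@measurable_proj i) pi setT _ mf.
rewrite preimage_setT => /(_ (bmeasurable_integrable _ (bfi i)) measurableT) <-.
apply: eq_measure_integral; first exact: measurable_proj.
by move=> mp A mA _; exact: cpl.
Qed.

(* A finitely additive mean with the prescribed marginals is tight, so its
   regularization is a coupling. *)
Lemma coupling_of_famean (L : (T -> R) -> R) (c : T -> R) :
  (forall i, separable (X i)) -> (forall i, locally_compact [set: X i]) ->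
  finitely_additive_mean L ->
  (forall i A, measurable (A : set (borel (X i))) ->
     ((L \1_[set x | A (x i)])%:E <= mu i A)%E) ->
  continuous c -> ubounded c ->
  exists2 pi, couplings mu pi & mean pi c <= L c.
Proof.
move=> sepX lcX meanL L_marg cc bc.
pose nu (A : set T) := L \1_A.
have T2 : hausdorff_space T.
  by apply: hausdorff_product => i; exact: metric_hausdorff.
have T3 : @regular_space T by exact: uniform_regular.
have tight e : 0 < e -> exists2 K : set T, compact K & nu (~` K) <= e.
  move=> e0; have r0 : 0 < e / k.+1%:R by rewrite divr_gt0.
  have /all_sig2[K cK muK] i : {K : set (X i) | compact K &
      (mu i (~` K) <= (e / k.+1%:R)%:E)%E}.
    by apply: cid2; exact: locally_compact_tight.
  exists [set x | forall i, K i (x i)]; first exact: tychonoff.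
  (* A point outside the product of the [K i] leaves some [K i], so the indicators of the cylinders
     over the complements sum to at least 1 there. *)
  apply: (@le_trans _ _ (L (\sum_(i < k) \1_[set x | (~` K i) (x i)]))).
    apply: (le_famean meanL) => //; first exact: ubounded_indic.
      by apply: ubounded_sum => i; exact: ubounded_indic.
    move=> x; rewrite fct_sumE indicE; have [Kx|/existsNP[i nKi]] :=
      pselect (forall i, K i (x i)).
      rewrite memNset; first by apply: sumr_ge0 => i _; rewrite indicE.
      by move=> /(_ Kx).
    rewrite (bigD1 i)//= indicE (_ : x \in [set x | ~ K i (x i)]); last first.
      by rewrite inE.
    apply: (@le_trans _ _ 1); first by rewrite lern1; case: (_ \in _).
    by rewrite lerDl; apply: sumr_ge0 => j _; rewrite indicE.
  rewrite (famean_sum meanL)//; last by move=> i; exact: ubounded_indic.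
  apply: (@le_trans _ _ (\sum_(i < k) e / k.+1%:R)).
    apply: ler_sum => i _; rewrite -lee_fin; apply: le_trans (muK i).
    apply: L_marg; apply: measurableC; apply: (@closed_borel (X i)).
    exact: compact_closed (@metric_hausdorff _ (X i)) (cK i).
  rewrite sumr_const card_ord -[leLHS]mulr_natr.
  by rewrite -mulrA ler_piMr ?(ltW e0)// ler_pdivrMl// mulr1 ler_nat.
have [pi piP] := @inner_regular_probability R _ nu T2 T3
  (famean_indic_ge0 meanL) (famean_indicU meanL) (famean_indicT meanL) tight.
exists pi; last exact: (layer_cake_le meanL piP cc bc).
move=> i A mA.
pose phi : {mfun borel T >-> borel (X i)} :=
  HB.pack (fun x : borel T => x i : borel (X i))
    (isMeasurableFun.Build _ _ _ _ _ (@measurable_proj i)).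
(* Only an upper bound on open sets is available, through [piP] and [L_marg]; total mass one turns
   it into equality of the marginals. *)
apply: (@probability_le_open_eq _ _ (distribution pi phi) (mu i)) => // U oU.
apply: le_trans (L_marg i U _); last exact: open_borel.
by apply: piP; exact: open_proj_preimage.
Qed.

End coupling.

(** * Duality and attainment *)

Local Open Scope ereal_scope.

Theorem theorem10p4 (R : realType) (k : nat) (k_gt0 : (0 < k)%N)
    (X : 'I_k -> pmetricType R)
    (polishX : forall i, polish R (X i))
    (lcX : forall i, locally_compact [set: X i])
    (c : prod_topology X -> R)
    (c_bounded : bounded_fun c)
    (c_lipschitz : prod_lipschitz c)
    (mu : forall i, probability (borel (X i)) R) :
  let D := [set \sum_(i < k) \int[mu i]_x (f i x)%:E
             | f in dual_admissible c] in
  let P := [set \int[pi]_x (c x)%:E | pi in couplings mu] in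
  [/\ ereal_sup D = ereal_inf P,
      exists2 f, dual_admissible c f &
        \sum_(i < k) \int[mu i]_x (f i x)%:E = ereal_sup D &
      exists2 pi, couplings mu pi &
        \int[pi]_x (c x)%:E = ereal_inf P].
Proof.
move=> D P.
have sepX i : separable (X i) by have [] := polishX i.
have bc : ubounded c by exact/bounded_funE.
have cc := prod_lipschitz_continuous c_lipschitz.
have [M cM] := bc.
(* [prod_lipschitz] leaves the sign of the constant free; it is replaced by its maximum with 0. *)
have [L L0 c_lip] : exists2 L, (0 <= L)%R &
    forall x y, (`|c x - c y| <= L * prod_mdist x y)%R.
  have [L cL] := c_lipschitz; exists (Num.max L 0)%R.
    by rewrite le_max lexx orbT.
  move=> x y; apply: le_trans (cL x y) _.
  apply: ler_wpM2r; last by rewrite le_max lexx.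
  by apply: sumr_ge0 => i _; exact: mdist_ge0.
have [Lam [meanLam Lam_marg Lam_adh]] :=
  marginal_mean_exists mu k_gt0 bc.
have improve := dual_class_improve mu k_gt0 cM L0 c_lip.
have [f df f_max] : exists2 f, dual_class c M L f &
    forall g, dual_class c M L g -> (total_mean mu g <= total_mean mu f)%R.
  apply: dual_class_max => //; have [g [bg gc _]] := Lam_adh 1%R ltr01.
  by have [f df _] := improve g bg gc; exists f.
have Lam_le : (Lam c <= total_mean mu f)%R.
  apply/ler_addgt0Pr => e e0; have [g [bg gc le]] := Lam_adh e e0.
  have [h dh gh] := improve g bg gc.
  by apply: le_trans le _; rewrite lerD2r (le_trans gh)// f_max.
have [pi cpl pi_le] := coupling_of_famean sepX lcX meanLam Lam_marg cc bc.
have bmc : bmeasurable (c : borel (prod_topology X) -> R).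
  by split => //; exact: continuous_borel.
have bm_adm g : dual_admissible c g -> bmeasurable_family g.
  move=> [gP _] i; have [cg bg] := gP i.
  by split; [exact: continuous_borel|exact/bounded_funE].
have totalE g : bmeasurable_family g ->
    \sum_(i < k) \int[mu i]_x (g i x)%:E = (total_mean mu g)%:E.
  by move=> bg; rewrite -sumEFin; apply: eq_bigr => i _; exact: meanE.
have weak g q : dual_admissible c g -> couplings mu q ->
    (total_mean mu g <= mean q c)%R.
  move=> ag cq; have bg := bm_adm _ ag.
  rewrite -(coupling_mean cq bg); apply: le_mean => //.
    exact: bmeasurable_oplus.
  exact: ag.2.
have af : dual_admissible c f.
  split; last exact: df.2.
  move=> i; split; first exact: lipschitz_with_continuous (df.1 i).1.
  by apply/bounded_funE; exists (2 * M)%R; exact: (df.1 i).2.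
(* The circle closes: [mean pi c] is at most [Lam c], which is at most [total_mean mu f], which weak
   duality bounds by [mean pi c]. So [f] and [pi] are both optimal. *)
have eqf : total_mean mu f = mean pi c.
  by apply/eqP; rewrite eq_le weak//= (le_trans pi_le).
have supD : ereal_sup D = (total_mean mu f)%:E.
  apply/eqP; rewrite eq_le; apply/andP; split.
    apply: ge_ereal_sup => _ [g ag <-]; rewrite totalE; last exact: bm_adm.
    by rewrite lee_fin eqf weak.
  by apply: ereal_sup_ubound; exists f => //; rewrite totalE//; exact: bm_adm.
have infP : ereal_inf P = (mean pi c)%:E.
  apply/eqP; rewrite eq_le; apply/andP; split.
    by apply: ereal_inf_lbound; exists pi => //; exact: meanE.
  by apply: le_ereal_inf_tmp => _ [q cq <-]; rewrite meanE// lee_fin -eqf weak.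
split; first by rewrite supD infP eqf.
- by exists f => //; rewrite supD totalE//; exact: bm_adm.
- by exists pi => //; rewrite infP; exact: meanE.
Qed.
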